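(* The monotone cones $\mathcal{C}^+=\{u\in\mathbb{R}^n: u_1\le u_2\le\dots\le u_n\}$ and $\mathcal{C}^-=\{b\in\mathbb{R}^n: b_1\ge b_2\ge\dots\ge b_n\}$ admit isotone projections; that is, for $\mathcal{C}=\mathcal{C}^+$ and for $\mathcal{C}=\mathcal{C}^-$, for all $u,v\in\mathbb{R}^n$, $v-u\in\mathcal{C}$ implies $P_{\mathcal{C}}v-P_{\mathcal{C}}u\in\mathcal{C}$.
   Context: $P_{\mathcal{C}}:\mathbb{R}^n\to\mathcal{C}$ denotes the metric projection onto the nonempty closed convex set $\mathcal{C}$ with respect to the Euclidean norm, i.e. $P_{\mathcal{C}}x$ is the unique point of $\mathcal{C}$ nearest to $x$. *)

(* Defs.v *)
From mathcomp Require Export all_boot all_order all_algebra.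
From mathcomp Require Export all_classical all_reals all_analysis.
From mathcomp Require Import lra ring.

Set Implicit Arguments.
Unset Strict Implicit.
Unset Printing Implicit Defensive.

Import Order.TTheory GRing.Theory Num.Theory.
Import numFieldNormedType.Exports.

Local Open Scope classical_set_scope.
Local Open Scope ring_scope.

(* The norm `|u| that the library puts on 'rV[R]_n is the sup norm, hence a
   separate Euclidean norm. *)
Definition enorm (R : realType) (n : nat) (u : 'rV[R]_n) : R :=
  Num.sqrt (\sum_(i < n) u 0 i ^+ 2).

Definition nearest_point (R : realType) (n : nat) (C : set 'rV[R]_n)
    (x p : 'rV[R]_n) : Prop :=
  C p /\ forall q, C q -> enorm (x - p) <= enorm (x - q).

(* The default value 0 is irrelevant when C is nonempty, closed and convex:
   see metric_proj_nearest and metric_proj_unique below. *)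
Definition metric_proj (R : realType) (n : nat) (C : set 'rV[R]_n)
    (x : 'rV[R]_n) : 'rV[R]_n :=
  xget 0 [set p | nearest_point C x p].

Definition isotone_projection (R : realType) (n : nat) (C : set 'rV[R]_n) :
    Prop :=
  forall u v : 'rV[R]_n, C (v - u) -> C (metric_proj C v - metric_proj C u).

Definition monotone_cone_up (R : realType) (n : nat) : set 'rV[R]_n :=
  [set u | forall i j : 'I_n, j = i.+1 :> nat -> u 0 i <= u 0 j].

Definition monotone_cone_down (R : realType) (n : nat) : set 'rV[R]_n :=
  [set b | forall i j : 'I_n, j = i.+1 :> nat -> b 0 i >= b 0 j].

Section metric_projection_theory.
Variables (R : realType) (n : nat).
Implicit Types (C : set 'rV[R]_n) (x p q : 'rV[R]_n).

Let sqs (u : 'rV[R]_n) : R := \sum_(i < n) u 0 i ^+ 2.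

Let sqs_ge0 u : 0 <= sqs u.
Proof. by apply: sumr_ge0 => i _; exact: sqr_ge0. Qed.

Let le_enorm u v : (enorm u <= enorm v) = (sqs u <= sqs v).
Proof. by rewrite /enorm ler_sqrt ?sqs_ge0. Qed.

Let sqs_continuous x : continuous (fun y : 'rV[R]_n => sqs (x - y)).
Proof.
apply: continuous_big => [|i _]; first exact: add_continuous.
rewrite (_ : (fun y : 'rV[R]_n => _) =
    fun y => (x 0 i - y 0 i) * (x 0 i - y 0 i)); last first.
  by apply/funext => y; rewrite !mxE expr2.
have cB : continuous (fun y : 'rV[R]_n => x 0 i - y 0 i).
  by move=> y; apply: (@continuousB R R^o) => /=;
    [exact: cst_continuous|exact: coord_continuous].
by move=> y; exact: (@continuousM R _ _ _ y (cB y) (cB y)).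
Qed.

Lemma exists_nearest_point C x :
  C !=set0 -> closed C -> exists p, nearest_point C x p.
Proof.
move=> [c Cc] clC; pose r := sqs (x - c).
pose K := C `&` (fun y : 'rV[R]_n => sqs (x - y)) @^-1` [set t | t <= r].
have clK : closed K.
  apply: closedI => //.
  by move/continuous_closedP: (@sqs_continuous x); apply; exact: closed_le.
have Kc : K c by split => //=.
have bK : bounded_set K.
  exists (`|x| + (r + 1)); split; first exact: num_real.
  move=> M ltM y [_ /= ley].
  apply: le_trans (ltW ltM).
  have -> : y = x - (x - y) by rewrite opprB addrC subrK.
  apply: le_trans (ler_normB _ _) _; rewrite lerD2l.
  rewrite [leLHS]/Num.norm /= mx_normrE; apply/bigmax_leP; split.
    by rewrite addr_ge0 ?sqs_ge0.
  move=> [i j] _ /=; rewrite ord1.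
  have h : (x - y) 0 j ^+ 2 <= r.
    apply: le_trans ley; rewrite /sqs (bigD1 j) //= lerDl.
    by apply: sumr_ge0 => k _; exact: sqr_ge0.
  move: h; rewrite -real_normK ?num_real //.
  by move: `|_| (normr_ge0 ((x - y) 0 j)) => t t0 h; nra.
have [|p Kp pmin] := @compact_EVT_min _ R (fun y : 'rV[R]_n => sqs (x - y)) K
  (ex_intro _ c Kc) (bounded_closed_compact bK clK).
  by apply: continuous_subspaceT; exact: sqs_continuous.
have [Cp lep] := set_mem Kp; exists p; split=> // q Cq; rewrite le_enorm.
have [leq|/ltW gtq] := leP (sqs (x - q)) r; last exact: le_trans gtq.
by apply: pmin; rewrite inE.
Qed.

Lemma nearest_point_unique C x p q :
  convex_set C -> nearest_point C x p -> nearest_point C x q -> p = q.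
Proof.
move=> cC [Cp pmin] [Cq qmin].
pose m : 'rV[R]_n := 2^-1 *: p + 2^-1 *: q.
have Cm : C m.
  have h01 : 0 <= (2^-1 : R) <= 1 by lra.
  have := cC p q (Itv01 (proj1 (andP h01)) (proj2 (andP h01))).
  rewrite !inE => /(_ Cp Cq); congr (C (_ + _ *: _)) => /=.
  by rewrite /unstable.onem; lra.
have := pmin _ Cm; have := qmin _ Cm; rewrite !le_enorm => hq hp.
have E : sqs (x - m) =
    2^-1 * sqs (x - p) + 2^-1 * sqs (x - q) - 4^-1 * sqs (p - q).
  rewrite /sqs !mulr_sumr -sumrN -!big_split; apply: eq_bigr => i _ /=.
  by rewrite !mxE; field.
have pq0 : sqs (p - q) = 0 by apply/eqP; rewrite eq_le sqs_ge0 andbT; lra.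
apply/rowP => i; apply/eqP; rewrite -subr_eq0 -sqrf_eq0.
have := psumr_eq0P (fun k _ => sqr_ge0 ((p - q) 0 k)) pq0.
by move=> /(_ i isT); rewrite !mxE => ->.
Qed.

Lemma metric_proj_nearest C x :
  C !=set0 -> closed C -> nearest_point C x (metric_proj C x).
Proof. by move=> C0 clC; apply: xgetPex; exact: exists_nearest_point. Qed.

Lemma metric_proj_unique C x p :
  convex_set C -> nearest_point C x p -> metric_proj C x = p.
Proof.
by move=> cC xp; apply: xget_unique => // q; move/nearest_point_unique; apply.
Qed.

End metric_projection_theory.

Section monotone_cones_theory.
Variables (R : realType) (n : nat).

Lemma monotone_cone_up_nonempty : @monotone_cone_up R n !=set0.
Proof. by exists 0 => i j _; rewrite !mxE. Qed.

Lemma monotone_cone_down_nonempty : @monotone_cone_down R n !=set0.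
Proof. by exists 0 => i j _; rewrite !mxE. Qed.

Let closed_coord_le (i j : 'I_n) : closed [set u : 'rV[R]_n | u 0 i <= u 0 j].
Proof.
rewrite (_ : mkset _ =
    (fun u : 'rV[R]_n => u 0 j - u 0 i) @^-1` [set t | 0 <= t]); last first.
  by apply/seteqP; split=> u /=; rewrite subr_ge0.
have : continuous (fun u : 'rV[R]_n => u 0 j - u 0 i).
  by move=> u; apply: (@continuousB R R^o); exact: coord_continuous.
by move/continuous_closedP; apply; exact: closed_ge.
Qed.

Lemma monotone_cone_up_closed : closed (@monotone_cone_up R n).
Proof.
rewrite (_ : @monotone_cone_up R n =
  \bigcap_(ij in [set ij : 'I_n * 'I_n | ij.2 = ij.1.+1 :> nat])
    [set u | u 0 ij.1 <= u 0 ij.2]); last first.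
  apply/seteqP; split=> u uC; first by move=> [i j] /=; exact: uC.
  by move=> i j ij; exact: (uC (i, j)).
by apply: closed_bigI => ij _; exact: closed_coord_le.
Qed.

Lemma monotone_cone_down_closed : closed (@monotone_cone_down R n).
Proof.
rewrite (_ : @monotone_cone_down R n =
  \bigcap_(ij in [set ij : 'I_n * 'I_n | ij.2 = ij.1.+1 :> nat])
    [set u | u 0 ij.2 <= u 0 ij.1]); last first.
  apply/seteqP; split=> u uC; first by move=> [i j] /=; exact: uC.
  by move=> i j ij; exact: (uC (i, j)).
by apply: closed_bigI => ij _; exact: closed_coord_le.
Qed.

Lemma monotone_cone_up_convex : convex_set (@monotone_cone_up R n).
Proof.
move=> x y t; rewrite !inE => xC yC i j ij.
rewrite !mxE; apply: lerD; apply: ler_wpM2l; rewrite ?unstable.onem_ge0 //.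
- exact: xC.
- exact: yC.
Qed.

Lemma monotone_cone_down_convex : convex_set (@monotone_cone_down R n).
Proof.
move=> x y t; rewrite !inE => xC yC i j ij.
rewrite !mxE; apply: lerD; apply: ler_wpM2l; rewrite ?unstable.onem_ge0 //.
- exact: xC.
- exact: yC.
Qed.

End monotone_cones_theory.

(* Main.v *)
Require Import Defs.
From mathcomp Require Import lra ring.

(** Fix neighbouring indices [i], [j = i + 1], put [d = v - u], and let [p], [q]
    be the projections of [u], [v] onto the nondecreasing cone.  If [p] does not
    jump between [i] and [j], then [q_j - q_i >= 0 = p_j - p_i] and nothing is to
    be proved.  If it does jump, the two projections are comparable separately on
    each side of the jump:
      [q_j >= p_j + d_j]   and   [q_i <= p_i + d_i],
    and subtracting gives [(q - p)_j - (q - p)_i >= d_j - d_i >= 0].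

    The first bound ([nearest_point_up_after_jump]) comes from testing the
    variational inequality [<x - P x, c - P x> <= 0] on both projections with one
    direction [w].  Let [w] be the positive part of [(p_j + d_j) - q] on the
    indices [>= j] and [0] before them.  Raising [q] by [w] stays in the cone, and
    so does lowering [p] by a small multiple of [w], because the jump of [p]
    absorbs the loss at [j].  The two inequalities combine to
    [<d + p - q, w> <= 0], whereas [d + p] is at least [p_j + d_j] on the
    support of [w]; hence [<w, w> <= 0].

    The second bound is the first one seen through the isometry
    [x |-> - x o rev], which preserves the cone, and the nonincreasing cone is
    the image of the nondecreasing one under [x |-> - x]. *)

Set Implicit Arguments.
Unset Strict Implicit.
Unset Printing Implicit Defensive.

Import Order.TTheory GRing.Theory Num.Theory.

Local Open Scope classical_set_scope.
Local Open Scope ring_scope.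

Section NearestPoint.
Variables (R : realType) (n : nat).
Implicit Types (C : set 'rV[R]_n) (x p c u : 'rV[R]_n).

Lemma enorm_le (u v : 'rV[R]_n) :
  (enorm u <= enorm v) = (\sum_k u 0 k ^+ 2 <= \sum_k v 0 k ^+ 2).
Proof. by rewrite /enorm ler_sqrt // sumr_ge0 // => k _; exact: sqr_ge0. Qed.

(** First-order optimality along the segment from [p] to [c]: with
    [A = <x - p, c - p>] and [B = |c - p|^2], minimality gives [2 A <= s B] for
    every [s] in [(0, 1]], which forces [A <= 0]. *)
Lemma nearest_point_variational C x p c :
  convex_set C -> nearest_point C x p -> C c ->
  \sum_k (x - p) 0 k * (c - p) 0 k <= 0.
Proof.
move=> cC [Cp pmin] Cc.
set A := \sum_k _; pose B := \sum_k (c - p) 0 k ^+ 2.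
have B0 : 0 <= B by apply: sumr_ge0 => k _; exact: sqr_ge0.
have step (s : R) : 0 <= s -> s <= 1 -> 2 * s * A <= s ^+ 2 * B.
  move=> s0 s1; pose m : 'rV[R]_n := s *: c + (1 - s) *: p.
  have Cm : C m by have := cC c p (Itv01 s0 s1); rewrite !inE => /(_ Cc Cp).
  have := pmin _ Cm; rewrite enorm_le -subr_ge0.
  suff -> : \sum_k (x - m) 0 k ^+ 2 - \sum_k (x - p) 0 k ^+ 2
            = s ^+ 2 * B - 2 * s * A by rewrite subr_ge0.
  rewrite /A /B !mulr_sumr -!sumrB; apply: eq_bigr => k _.
  by rewrite !mxE; ring.
rewrite leNgt; apply/negP => A0.
have AB0 : 0 < A + B by lra.
(* any [s] in [(0, 1]] with [s B < 2 A] contradicts minimality *)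
have := step (A / (A + B)).
rewrite divr_ge0 ?(ltW A0) ?(ltW AB0) // ler_pdivrMr // mul1r lerDl B0.
move=> /(_ isT isT).
have -> : 2 * (A / (A + B)) * A = 2 * A * (A + B) * A / (A + B) ^+ 2.
  by field; rewrite gt_eqF.
have -> : (A / (A + B)) ^+ 2 * B = A ^+ 2 * B / (A + B) ^+ 2.
  by field; rewrite gt_eqF.
rewrite ler_pM2r ?invr_gt0 ?exprn_gt0 //.
have A3 : 0 < A ^+ 3 by rewrite exprn_gt0.
have A2B : 0 <= A ^+ 2 * B by rewrite mulr_ge0 ?sqr_ge0.
by rewrite leNgt => /negP; apply; nra.
Qed.

Lemma nearest_point_isometry C (D : set 'rV[R]_n)
    (f : 'rV[R]_n -> 'rV[R]_n) x p :
  {morph f : u v / u - v} -> {mono f : u / enorm u} -> involutive f ->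
  (forall u, C u -> D (f u)) -> (forall u, D u -> C (f u)) ->
  nearest_point C x p -> nearest_point D (f x) (f p).
Proof.
move=> fB fnorm fK CD DC [Cp pmin]; split; first exact: CD.
move=> q Dq; rewrite -fB fnorm -(fK q) -fB fnorm.
exact/pmin/DC.
Qed.

End NearestPoint.

Section MonotoneCones.
Variables (R : realType) (n : nat).
Implicit Types (u v p q : 'rV[R]_n).

Local Notation up := (@monotone_cone_up R n).
Local Notation down := (@monotone_cone_down R n).

Lemma monotone_cone_up_le u (i j : 'I_n) :
  up u -> (i <= j)%N -> u 0 i <= u 0 j.
Proof.
move=> uC; case: j => j jn /=.
elim: j jn => [|j IH] jn; first by rewrite leqn0 => /eqP i0;
  rewrite (_ : i = Ordinal jn) //; apply: val_inj.
rewrite leq_eqVlt => /orP[/eqP ij|].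
  by rewrite (_ : i = Ordinal jn) //; apply: val_inj.
rewrite ltnS => ij; apply: le_trans (IH (ltnW jn) ij) _.
exact: uC.
Qed.

(** The jump of [p] is what leaves room to lower [p] from [j] on; testing the
    optimality of [p] and of [q] with the same [w] then cancels everything
    except [v - u], [p] and [q]. *)
Lemma nearest_point_up_after_jump u v p q (i j : 'I_n) :
  up (v - u) -> nearest_point up u p -> nearest_point up v q ->
  j = i.+1 :> nat -> p 0 i < p 0 j ->
  p 0 j + (v - u) 0 j <= q 0 j.
Proof.
move=> dC near_u near_v ij jump; set a := p 0 j + _.
have [[Cp _] [Cq _]] := (near_u, near_v).
pose w : 'rV[R]_n :=
  \row_k (if (j <= k)%N then Num.max 0 (a - q 0 k) else 0).
have w0 k : 0 <= w 0 k by rewrite mxE; case: ifP => // _; rewrite le_max lexx.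
rewrite leNgt; apply/negP => qa.
have wj : w 0 j = a - q 0 j.
  by rewrite mxE leqnn max_r // subr_ge0 ltW.
have wj0 : 0 < w 0 j by rewrite wj subr_gt0.
(* raising [q] by [w] replaces [q] by [max q a] on the indices from [j] on *)
have Cqw : up (q + w).
  move=> k l kl; have qkl := Cq k l kl; rewrite !mxE.
  have [jk|kj] := leqP j k.
    have raise y : y + Num.max 0 (a - y) = Num.max y a.
      by rewrite addr_maxr addr0 addrC subrK.
    by rewrite kl leqW // !raise ge_max !le_max qkl lexx orbT.
  by rewrite addr0; have := w0 l; rewrite mxE; lra.
(* the scale makes the decrease at [j] equal to the jump *)
pose s := (p 0 j - p 0 i) / w 0 j.
have s0 : 0 < s by rewrite divr_gt0 // subr_gt0.
have Cpw : up (p - s *: w).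
  move=> k l kl; have pkl := Cp k l kl; have qkl := Cq k l kl.
  have entry m : (p - s *: w) 0 m = p 0 m - s * w 0 m by rewrite 3!mxE.
  rewrite !entry.
  have [jk|kj] := leqP j k.
    rewrite lerB // ler_pM2l // !mxE jk kl leqW //.
    by rewrite ge_max le_max lexx /= le_max lerB ?orbT.
  have -> : w 0 k = 0 by rewrite mxE leqNgt kj.
  have [jl|lj] := leqP j l; last first.
    by rewrite [w 0 l]mxE leqNgt lj /= mulr0 !subr0.
  have lj : l = j by apply/val_inj/eqP; rewrite eqn_leq jl andbT /= kl.
  have ki : k = i by apply: val_inj; apply: succn_inj; rewrite -kl -ij lj.
  by rewrite lj ki divfK ?gt_eqF //; lra.
have Hq := nearest_point_variational (@monotone_cone_up_convex R n) near_v Cqw.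
have Hp := nearest_point_variational (@monotone_cone_up_convex R n) near_u Cpw.
have {}Hq : \sum_k (v - q) 0 k * w 0 k <= 0.
  by rewrite [q + w]addrC addrK in Hq.
have {}Hp : 0 <= \sum_k (u - p) 0 k * w 0 k.
  rewrite -(pmulr_rge0 _ s0) -oppr_le0 mulr_sumr -sumrN.
  apply: le_trans Hp; rewrite le_eqVlt; apply/orP; left; apply/eqP.
  by apply: eq_bigr => k _; rewrite !mxE; ring.
have : \sum_k w 0 k ^+ 2 <= 0.
  apply: (@le_trans _ _
    (\sum_k (v - q) 0 k * w 0 k - \sum_k (u - p) 0 k * w 0 k)); last by lra.
  rewrite -sumrB; apply: ler_sum => k _; rewrite -mulrBl expr2.
  (* where [w] is nonzero, [p] and [v - u] are at least their values at [j],
     so the left factor is at least [a - q], which is [w] there *)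
  have [wk0|] := eqVneq (w 0 k) 0; first by rewrite wk0 !mulr0.
  move=> wk0; apply: ler_wpM2r => //.
  move: wk0; rewrite [w 0 k]mxE; case: ifP => [jk|]; last by rewrite eqxx.
  rewrite maxEle; case: ifP => [_ _|]; last by rewrite eqxx.
  have := monotone_cone_up_le Cp jk; have := monotone_cone_up_le dC jk.
  by rewrite /a !mxE; lra.
apply/negP; rewrite -ltNge (bigD1 j) //= ltr_wpDr ?exprn_gt0 //.
by apply: sumr_ge0 => k _; exact: sqr_ge0.
Qed.

Definition opp_rev u : 'rV[R]_n := \row_k - u 0 (rev_ord k).

Lemma opp_revB : {morph opp_rev : u v / u - v}.
Proof. by move=> u v; apply/rowP => k; rewrite !mxE; ring. Qed.

Lemma opp_revK : involutive opp_rev.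
Proof. by move=> u; apply/rowP => k; rewrite !mxE rev_ordK opprK. Qed.

Lemma enorm_opp_rev : {mono opp_rev : u / enorm u}.
Proof.
move=> u; rewrite /enorm (reindex_inj rev_ord_inj) /=; congr Num.sqrt.
by apply: eq_bigr => k _; rewrite mxE sqrrN rev_ordK.
Qed.

Lemma opp_rev_up u : up u -> up (opp_rev u).
Proof.
move=> uC i j ij; rewrite !mxE lerN2; apply: uC => /=.
by rewrite ij subnSK // -ij.
Qed.

(** [opp_rev] swaps the two sides of a jump and reverses inequalities, so this is
    [nearest_point_up_after_jump] for the reflected data. *)
Lemma nearest_point_up_before_jump u v p q (i j : 'I_n) :
  up (v - u) -> nearest_point up u p -> nearest_point up v q ->
  j = i.+1 :> nat -> p 0 i < p 0 j ->
  q 0 i <= p 0 i + (v - u) 0 i.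
Proof.
move=> dC near_u near_v ij jump.
have mirror x y :
  nearest_point up x y -> nearest_point up (opp_rev x) (opp_rev y).
  by apply: nearest_point_isometry opp_revB enorm_opp_rev opp_revK _ _;
    exact: opp_rev_up.
have := @nearest_point_up_after_jump (opp_rev u) (opp_rev v) _ _
  (rev_ord j) (rev_ord i) _ (mirror _ _ near_u) (mirror _ _ near_v).
rewrite -opp_revB !mxE !rev_ordK ltrN2 => H.
have : - p 0 i - (v 0 i - u 0 i) <= - q 0 i.
  apply: H => //; first exact: opp_rev_up.
  by rewrite /= ij subnSK // -ij.
by lra.
Qed.

Lemma isotone_projection_up : isotone_projection up.
Proof.
move=> u v dC i j ij.
have near x : nearest_point up x (metric_proj up x).
  apply: metric_proj_nearest; first exact: monotone_cone_up_nonempty.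
  exact: monotone_cone_up_closed.
have dij := dC i j ij.
have [Cp _] := near u; have [Cq _] := near v.
have pij := Cp i j ij; have qij := Cq i j ij.
have [jump|flat] := ltP (metric_proj up u 0 i) (metric_proj up u 0 j).
  have := nearest_point_up_after_jump dC (near u) (near v) ij jump.
  have := nearest_point_up_before_jump dC (near u) (near v) ij jump.
  by move: dij; rewrite !mxE; lra.
by rewrite !mxE; lra.
Qed.

Lemma opp_up u : up u -> down (- u).
Proof. by move=> uC i j ij; rewrite !mxE lerN2; exact: uC. Qed.

Lemma opp_down u : down u -> up (- u).
Proof. by move=> uC i j ij; rewrite !mxE lerN2; exact: uC. Qed.

Lemma metric_proj_down u : metric_proj down u = - metric_proj up (- u).
Proof.
apply: metric_proj_unique; first exact: monotone_cone_down_convex.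
rewrite -{1}(opprK u).
apply: (@nearest_point_isometry _ _ up down -%R).
- by move=> x y; rewrite opprD.
- move=> x; rewrite /enorm; congr Num.sqrt.
  by apply: eq_bigr => k _; rewrite mxE sqrrN.
- exact: opprK.
- exact: opp_up.
- exact: opp_down.
apply: metric_proj_nearest; first exact: monotone_cone_up_nonempty.
exact: monotone_cone_up_closed.
Qed.

Lemma isotone_projection_down : isotone_projection down.
Proof.
move=> u v dC; rewrite !metric_proj_down -opprD; apply: opp_up.
by apply: isotone_projection_up; rewrite -opprD; exact: opp_down.
Qed.

End MonotoneCones.

Theorem corollary2 (R : realType) (n : nat) :
  isotone_projection (@monotone_cone_up R n) /\
  isotone_projection (@monotone_cone_down R n).
Proof.
split; [exact: isotone_projection_up | exact: isotone_projection_down].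
Qed.
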